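(* The log-harmonic mapping $$f_{1/2}(z)=\frac{z}{1-z}\exp\left(\operatorname{Re}\left(\frac{2z}{1-z}\right)\right),\qquad z\in\mathbb{D},$$ maps $\mathbb{D}$ univalently onto the right half-plane $\left\{w\in\mathbb{C}:\operatorname{Re}w>-\frac{1}{2e}\right\}$.
   Context: $\mathbb{D}$ is the open unit disk in $\mathbb{C}$; univalent means injective. A log-harmonic mapping on $\mathbb{D}$ is a solution $f$ of $\overline{f_{\overline{z}}}=\mu\,(\overline{f}/f)\,f_z$ for some analytic $\mu$ on $\mathbb{D}$ with $|\mu|<1$; here $\mu(z)=z$. *)

(* Defs.v *)
(* Stdlib real numbers with Coquelicot; [C] is Coquelicot's field of complex
   numbers, i.e. pairs of reals. *)
From Stdlib Require Import Reals.
From Coquelicot Require Import Coquelicot.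
Open Scope R_scope.

Definition unit_disk (z : C) : Prop := Cmod z < 1.

(* [ex_derive] is instantiated at the complex scalars, so this is complex
   differentiability at every point of the (open) disk. *)
Definition analytic_on_disk (mu : C -> C) : Prop :=
  forall z : C, unit_disk z -> @ex_derive C_AbsRing C_NormedModule mu z.

(* Partial derivatives with respect to the real and imaginary parts of [z].
   They are total functions, meaningful where [ex_partials] holds. *)
Definition partial_x (f : C -> C) (z : C) : C :=
  (Derive (fun t : R => Re (f (t, Im z))) (Re z),
   Derive (fun t : R => Im (f (t, Im z))) (Re z)).

Definition partial_y (f : C -> C) (z : C) : C :=
  (Derive (fun t : R => Re (f (Re z, t))) (Im z),
   Derive (fun t : R => Im (f (Re z, t))) (Im z)).

Definition ex_partials (f : C -> C) (z : C) : Prop :=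
  ex_derive (fun t : R => Re (f (t, Im z))) (Re z) /\
  ex_derive (fun t : R => Im (f (t, Im z))) (Re z) /\
  ex_derive (fun t : R => Re (f (Re z, t))) (Im z) /\
  ex_derive (fun t : R => Im (f (Re z, t))) (Im z).

Definition C1_on_disk (f : C -> C) : Prop :=
  forall z : C, unit_disk z ->
    ex_partials f z /\
    @continuous C_UniformSpace C_UniformSpace (partial_x f) z /\
    @continuous C_UniformSpace C_UniformSpace (partial_y f) z.

(* Wirtinger derivatives f_z and f_{\bar z}. *)
Definition wirtinger_z (f : C -> C) (z : C) : C :=
  ((partial_x f z - Ci * partial_y f z) / RtoC 2)%C.

Definition wirtinger_zbar (f : C -> C) (z : C) : C :=
  ((partial_x f z + Ci * partial_y f z) / RtoC 2)%C.

(* [f] is a (classical, i.e. continuously differentiable) solution on the disk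
   of the log-harmonic equation with second dilatation [mu].  At a zero of [f]
   the quotient [Cconj (f z) / f z] evaluates to 0, so there the equation reads
   [wirtinger_zbar f z = 0]; elsewhere it is the usual one. *)
Definition log_harmonic_with (mu f : C -> C) : Prop :=
  analytic_on_disk mu /\
  (forall z : C, unit_disk z -> Cmod (mu z) < 1) /\
  C1_on_disk f /\
  (forall z : C, unit_disk z ->
     Cconj (wirtinger_zbar f z)
     = (mu z * (Cconj (f z) / f z) * wirtinger_z f z)%C).

Definition univalent_on_disk (f : C -> C) : Prop :=
  forall z1 z2 : C, unit_disk z1 -> unit_disk z2 -> f z1 = f z2 -> z1 = z2.

Definition maps_disk_onto (f : C -> C) (W : C -> Prop) : Prop :=
  forall w : C, W w <-> exists z : C, unit_disk z /\ f z = w.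

Definition f_half (z : C) : C :=
  (z / (RtoC 1 - z)
   * RtoC (exp (Re (RtoC 2 * z / (RtoC 1 - z)))))%C.

(* Main.v *)
Require Import Defs.
From Stdlib Require Import Reals Lra.
From Coquelicot Require Import Coquelicot.
Open Scope R_scope.

(** The mapping factors through a half-plane.  Put [w = z / (1 - z)], the
    Moebius map [cayley], which carries the disk bijectively onto the half-plane
    [Re w > -1/2].  Since [2z / (1 - z) = 2w], the mapping is [stretch o cayley]
    with [stretch w = w * exp (2 Re w)].  With [w = u + iv],
    [stretch w = (u * exp (2u), v * exp (2u))].

    Geometry.  The function [u * exp (2u)] increases strictly on
    [[-1/2, +oo)] from its minimum [-1/(2e)] to infinity ([mult_exp_lt],
    [mult_exp_min], [mult_exp_surj]), so the first coordinate of [stretch w]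
    determines [u], after which [v] is recovered by dividing by [exp (2u)].
    Hence [stretch] is a bijection from [Re w > -1/2] onto
    [Re w > -1/(2e)], and composing with [cayley] gives both univalence and
    the image.

    Differential equation.  Formally,
    [log f = log w + w + conj w] with [w] analytic in [z], so
    [f_zbar = conj w' * f] ([wirtinger_zbar_f_half]) and
    [f_z = w' * (1 + w) * exp (2 Re w)] ([wirtinger_z_f_half]).  The dilatation is
    therefore [w / (1 + w)], which is [z] ([cayley_mult_id]).  The two
    Wirtinger derivatives come from the real chain rule applied to [stretch]
    along horizontal and vertical lines, and the formulas hold on all of
    [Re z < 1], an open set containing the disk. *)

(** * The factorization through a half-plane *)

Definition cayley (z : C) : C := (z / (RtoC 1 - z))%C.

(** The complex derivative of [cayley]. *)
Definition dcayley (z : C) : C := (/ ((RtoC 1 - z) * (RtoC 1 - z)))%C.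

Definition stretch (w : C) : C := (w * RtoC (exp (2 * Re w)))%C.

(** The real differential of [stretch] at [w], applied to the direction [d]; it
    is only real-linear in [d]. *)
Definition dstretch (w d : C) : C :=
  ((d + RtoC (2 * Re d) * w) * RtoC (exp (2 * Re w)))%C.

Lemma f_half_stretch (z : C) : f_half z = stretch (cayley z).
Proof.
  unfold f_half, stretch.
  replace (RtoC 2 * z / (RtoC 1 - z))%C with (RtoC 2 * cayley z)%C
    by (unfold cayley, Cdiv; ring).
  rewrite re_scal_l. reflexivity.
Qed.

Lemma stretch_components (w : C) :
  stretch w = (Re w * exp (2 * Re w), Im w * exp (2 * Re w)).
Proof.
  unfold stretch, Cmult, RtoC, Re, Im; simpl. f_equal; ring.
Qed.

Lemma unit_disk_Re_lt_1 (z : C) : unit_disk z -> Re z < 1.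
Proof.
  unfold unit_disk. intros Hz.
  pose proof (Cmod_ge_0 z). pose proof (Cmod2_alt z).
  pose proof (pow2_ge_0 (Im z)). nra.
Qed.

Lemma one_minus_neq_0 (z : C) : Re z < 1 -> (RtoC 1 - z <> 0)%C.
Proof.
  intros Hz H. apply (f_equal Re) in H.
  unfold Re in *; simpl in H. lra.
Qed.

Lemma norm_one_minus_pos (x y : R) : x < 1 -> 0 < (1 - x) ^ 2 + y ^ 2.
Proof. intros Hx. nra. Qed.

Lemma cayley_components (x y : R) : x < 1 ->
  cayley (x, y) =
  ((x * (1 - x) - y ^ 2) / ((1 - x) ^ 2 + y ^ 2), y / ((1 - x) ^ 2 + y ^ 2)).
Proof.
  intros Hx. pose proof (norm_one_minus_pos x y Hx).
  unfold cayley, Cdiv, Cinv, Cmult, Cminus, Cplus, Copp, RtoC; simpl.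
  f_equal; field; nra.
Qed.

Lemma dcayley_components (x y : R) : x < 1 ->
  dcayley (x, y) =
  (((1 - x) ^ 2 - y ^ 2) / ((1 - x) ^ 2 + y ^ 2) ^ 2,
   2 * (1 - x) * y / ((1 - x) ^ 2 + y ^ 2) ^ 2).
Proof.
  intros Hx. pose proof (norm_one_minus_pos x y Hx) as HN.
  assert (H1 : (RtoC 1 - (x, y) <> 0)%C) by (apply one_minus_neq_0; exact Hx).
  unfold dcayley.
  transitivity ((/ (RtoC 1 - (x, y))) * (/ (RtoC 1 - (x, y))))%C.
  { field. exact H1. }
  unfold Cinv, Cmult, Cminus, Cplus, Copp, RtoC; simpl.
  f_equal; field; nra.
Qed.

(** * Partial derivatives *)

Lemma is_derive_cayley_x (x y : R) : x < 1 ->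
  is_derive (fun t : R => Re (cayley (t, y))) x (Re (dcayley (x, y))) /\
  is_derive (fun t : R => Im (cayley (t, y))) x (Im (dcayley (x, y))).
Proof.
  intros Hx. pose proof (norm_one_minus_pos x y Hx) as HN.
  rewrite dcayley_components by exact Hx.
  unfold cayley, Cdiv, Cinv, Cmult, Cminus, Cplus, Copp, RtoC, Re, Im; simpl.
  split; auto_derive; try nra; field; nra.
Qed.

(** The factor [Ci] is the direction of a vertical line: this and the preceding
    lemma together are the Cauchy-Riemann equations for [cayley]. *)
Lemma is_derive_cayley_y (x y : R) : x < 1 ->
  is_derive (fun t : R => Re (cayley (x, t))) y (Re (Ci * dcayley (x, y))) /\
  is_derive (fun t : R => Im (cayley (x, t))) y (Im (Ci * dcayley (x, y))).
Proof.
  intros Hx. pose proof (norm_one_minus_pos x y Hx) as HN.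
  rewrite dcayley_components by exact Hx.
  unfold cayley, Ci, Cdiv, Cinv, Cmult, Cminus, Cplus, Copp, RtoC, Re, Im; simpl.
  split; auto_derive; try nra; field; nra.
Qed.

(** Both components of [stretch] have this form: the imaginary one directly, the
    real one with [v = u]. *)
Lemma is_derive_mult_exp (u v : R -> R) (t a b : R) :
  is_derive u t a -> is_derive v t b ->
  is_derive (fun s : R => v s * exp (2 * u s)) t
    ((b + 2 * a * v t) * exp (2 * u t)).
Proof.
  intros Hu Hv.
  assert (Eu : ex_derive u t) by (eexists; exact Hu).
  assert (Ev : ex_derive v t) by (eexists; exact Hv).
  auto_derive; [tauto |].
  apply is_derive_unique in Hu. apply is_derive_unique in Hv.
  change (Derive (fun x : R => u x) t) with (Derive u t).
  change (Derive (fun x : R => v x) t) with (Derive v t).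
  rewrite Hu, Hv. ring.
Qed.

Lemma is_derive_stretch (g : R -> C) (t : R) (d : C) :
  is_derive (fun s : R => Re (g s)) t (Re d) ->
  is_derive (fun s : R => Im (g s)) t (Im d) ->
  is_derive (fun s : R => Re (stretch (g s))) t (Re (dstretch (g t) d)) /\
  is_derive (fun s : R => Im (stretch (g s))) t (Im (dstretch (g t) d)).
Proof.
  intros HRe HIm. split.
  - apply (is_derive_ext (fun s : R => Re (g s) * exp (2 * Re (g s)))).
    { intros s. rewrite stretch_components. reflexivity. }
    replace (Re (dstretch (g t) d))
      with ((Re d + 2 * Re d * Re (g t)) * exp (2 * Re (g t)))
      by (unfold dstretch, Re, Im; simpl; ring).
    exact (is_derive_mult_exp _ _ t _ _ HRe HRe).
  - apply (is_derive_ext (fun s : R => Im (g s) * exp (2 * Re (g s)))).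
    { intros s. rewrite stretch_components. reflexivity. }
    replace (Im (dstretch (g t) d))
      with ((Im d + 2 * Re d * Im (g t)) * exp (2 * Re (g t)))
      by (unfold dstretch, Re, Im; simpl; ring).
    exact (is_derive_mult_exp _ _ t _ _ HRe HIm).
Qed.

Lemma is_derive_f_half_x (x y : R) : x < 1 ->
  let d := dstretch (cayley (x, y)) (dcayley (x, y)) in
  is_derive (fun t : R => Re (f_half (t, y))) x (Re d) /\
  is_derive (fun t : R => Im (f_half (t, y))) x (Im d).
Proof.
  intros Hx. destruct (is_derive_cayley_x x y Hx) as [HRe HIm].
  destruct (is_derive_stretch (fun t => cayley (t, y)) x _ HRe HIm) as [H1 H2].
  split; eapply is_derive_ext; try eassumption;
    intros t; cbv beta; rewrite f_half_stretch; reflexivity.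
Qed.

Lemma is_derive_f_half_y (x y : R) : x < 1 ->
  let d := dstretch (cayley (x, y)) (Ci * dcayley (x, y)) in
  is_derive (fun t : R => Re (f_half (x, t))) y (Re d) /\
  is_derive (fun t : R => Im (f_half (x, t))) y (Im d).
Proof.
  intros Hx. destruct (is_derive_cayley_y x y Hx) as [HRe HIm].
  destruct (is_derive_stretch (fun t => cayley (x, t)) y _ HRe HIm) as [H1 H2].
  split; eapply is_derive_ext; try eassumption;
    intros t; cbv beta; rewrite f_half_stretch; reflexivity.
Qed.

Lemma ex_partials_f_half (z : C) : Re z < 1 -> ex_partials f_half z.
Proof.
  destruct z as [x y]. intros Hx.
  destruct (is_derive_f_half_x x y Hx) as [H1 H2].
  destruct (is_derive_f_half_y x y Hx) as [H3 H4].
  unfold ex_partials.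
  split; [|split; [|split]]; eexists; eassumption.
Qed.

Lemma partial_x_f_half (z : C) : Re z < 1 ->
  partial_x f_half z = dstretch (cayley z) (dcayley z).
Proof.
  destruct z as [x y]. intros Hx.
  destruct (is_derive_f_half_x x y Hx) as [H1 H2].
  apply injective_projections; apply is_derive_unique; assumption.
Qed.

Lemma partial_y_f_half (z : C) : Re z < 1 ->
  partial_y f_half z = dstretch (cayley z) (Ci * dcayley z).
Proof.
  destruct z as [x y]. intros Hx.
  destruct (is_derive_f_half_y x y Hx) as [H1 H2].
  apply injective_projections; apply is_derive_unique; assumption.
Qed.

(** * Continuity of the partial derivatives *)

Lemma locally_Re_lt_1 (z : C) : Re z < 1 ->
  @locally C_UniformSpace z (fun u : C => Re u < 1).
Proof.
  destruct z as [x y]. intros Hx.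
  apply (continuous_fst (U := R_UniformSpace) (V := R_UniformSpace) x y
           (fun t => t < 1)).
  exact (open_lt 1 x Hx).
Qed.

(** The topology on [C] here is the product one, so continuity of complex-valued
    functions reduces to that of their real components. *)
Lemma continuous_components (f : C -> C) (z : C) :
  @continuous C_UniformSpace R_UniformSpace (fun u => Re (f u)) z ->
  @continuous C_UniformSpace R_UniformSpace (fun u => Im (f u)) z ->
  @continuous C_UniformSpace C_UniformSpace f z.
Proof.
  intros HRe HIm.
  apply (continuous_ext (T := C_UniformSpace) (U := C_UniformSpace)
           (fun u => (Re (f u), Im (f u)))).
  { intros u. symmetry. apply surjective_pairing. }
  apply (continuous_comp_2 (U := C_UniformSpace) (V := R_UniformSpace)
          (W := R_UniformSpace) (X := C_UniformSpace)
          (fun u => Re (f u)) (fun u => Im (f u)) (fun a b => (a, b)) z HRe HIm).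
  apply (continuous_ext (T := C_UniformSpace) (U := C_UniformSpace) (fun u => u)).
  { intros u. apply surjective_pairing. }
  apply continuous_id.
Qed.

Lemma continuous_Re_C (z : C) :
  @continuous C_UniformSpace R_UniformSpace Re z.
Proof. destruct z as [x y]. apply (continuous_fst (U := R_UniformSpace)). Qed.

Lemma continuous_Im_C (z : C) :
  @continuous C_UniformSpace R_UniformSpace Im z.
Proof. destruct z as [x y]. apply (continuous_snd (U := R_UniformSpace)). Qed.

Lemma continuous_Re (f : C -> C) (z : C) :
  @continuous C_UniformSpace C_UniformSpace f z ->
  @continuous C_UniformSpace R_UniformSpace (fun u => Re (f u)) z.
Proof.
  intros H. apply (continuous_comp (V := C_UniformSpace) f Re z H).
  apply continuous_Re_C.
Qed.

Lemma continuous_Im (f : C -> C) (z : C) :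
  @continuous C_UniformSpace C_UniformSpace f z ->
  @continuous C_UniformSpace R_UniformSpace (fun u => Im (f u)) z.
Proof.
  intros H. apply (continuous_comp (V := C_UniformSpace) f Im z H).
  apply continuous_Im_C.
Qed.

Lemma continuous_Cplus (f g : C -> C) (z : C) :
  @continuous C_UniformSpace C_UniformSpace f z ->
  @continuous C_UniformSpace C_UniformSpace g z ->
  @continuous C_UniformSpace C_UniformSpace (fun u => f u + g u)%C z.
Proof.
  intros Hf Hg. apply continuous_components.
  - apply (continuous_plus (K := R_AbsRing) (V := R_NormedModule)
      (fun u => Re (f u)) (fun u => Re (g u))); apply continuous_Re; assumption.
  - apply (continuous_plus (K := R_AbsRing) (V := R_NormedModule)
      (fun u => Im (f u)) (fun u => Im (g u))); apply continuous_Im; assumption.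
Qed.

Lemma continuous_Cmult (f g : C -> C) (z : C) :
  @continuous C_UniformSpace C_UniformSpace f z ->
  @continuous C_UniformSpace C_UniformSpace g z ->
  @continuous C_UniformSpace C_UniformSpace (fun u => f u * g u)%C z.
Proof.
  intros Hf Hg.
  pose proof (continuous_Re _ _ Hf). pose proof (continuous_Im _ _ Hf).
  pose proof (continuous_Re _ _ Hg). pose proof (continuous_Im _ _ Hg).
  apply continuous_components.
  - apply (continuous_minus (K := R_AbsRing) (V := R_NormedModule)
      (fun u => Re (f u) * Re (g u)) (fun u => Im (f u) * Im (g u)));
      apply (continuous_mult (K := R_AbsRing)); assumption.
  - apply (continuous_plus (K := R_AbsRing) (V := R_NormedModule)
      (fun u => Re (f u) * Im (g u)) (fun u => Im (f u) * Re (g u)));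
      apply (continuous_mult (K := R_AbsRing)); assumption.
Qed.

Lemma continuous_RtoC (f : C -> R) (z : C) :
  @continuous C_UniformSpace R_UniformSpace f z ->
  @continuous C_UniformSpace C_UniformSpace (fun u => RtoC (f u)) z.
Proof.
  intros Hf. apply continuous_components; [exact Hf | apply continuous_const].
Qed.

Lemma continuous_Cinv (f : C -> C) (z : C) :
  @continuous C_UniformSpace C_UniformSpace f z -> f z <> RtoC 0 ->
  @continuous C_UniformSpace C_UniformSpace (fun u => / f u)%C z.
Proof.
  intros Hf H0.
  pose proof (continuous_Re _ _ Hf) as HRe.
  pose proof (continuous_Im _ _ Hf) as HIm.
  assert (Hsq : forall h : C -> R,
            @continuous C_UniformSpace R_UniformSpace h z ->
            @continuous C_UniformSpace R_UniformSpace (fun u => h u ^ 2) z).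
  { intros h Hh.
    apply (continuous_mult (K := R_AbsRing) h (fun u => h u * 1)); [exact Hh |].
    apply (continuous_mult (K := R_AbsRing) h (fun _ => 1)); [exact Hh |].
    apply continuous_const. }
  assert (Hinv : @continuous C_UniformSpace R_UniformSpace
            (fun u => / (Re (f u) ^ 2 + Im (f u) ^ 2)) z).
  { apply (continuous_comp (U := C_UniformSpace) (V := R_UniformSpace)
             (W := R_UniformSpace) (fun u => Re (f u) ^ 2 + Im (f u) ^ 2) Rinv).
    - exact (continuous_plus (K := R_AbsRing) (V := R_NormedModule)
               _ _ z (Hsq _ HRe) (Hsq _ HIm)).
    - apply continuous_Rinv. rewrite <- Cmod2_alt.
      apply pow_nonzero. intros H. apply H0, Cmod_eq_0, H. }
  apply continuous_components; unfold Cinv.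
  - exact (continuous_mult (K := R_AbsRing) _ _ z HRe Hinv).
  - apply (continuous_mult (K := R_AbsRing) (fun u => - Im (f u)) _ z);
      [| exact Hinv].
    exact (continuous_opp (K := R_AbsRing) (V := R_NormedModule) _ z HIm).
Qed.

Lemma continuous_one_minus (z : C) :
  @continuous C_UniformSpace C_UniformSpace (fun u => RtoC 1 - u)%C z.
Proof.
  apply (continuous_ext (T := C_UniformSpace) (U := C_UniformSpace)
           (fun u => RtoC 1 + - RtoC 1 * u)%C).
  { intros u. apply injective_projections; simpl; ring. }
  apply continuous_Cplus; [apply continuous_const |].
  apply continuous_Cmult; [apply continuous_const | apply continuous_id].
Qed.

Lemma continuous_cayley (z : C) : Re z < 1 ->
  @continuous C_UniformSpace C_UniformSpace cayley z.
Proof.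
  intros Hz. apply continuous_Cmult; [apply continuous_id |].
  apply continuous_Cinv; [apply continuous_one_minus |].
  apply one_minus_neq_0, Hz.
Qed.

Lemma continuous_dcayley (z : C) : Re z < 1 ->
  @continuous C_UniformSpace C_UniformSpace dcayley z.
Proof.
  intros Hz. apply continuous_Cinv.
  - apply continuous_Cmult; apply continuous_one_minus.
  - apply Cmult_neq_0; apply one_minus_neq_0, Hz.
Qed.

Lemma continuous_dstretch (g d : C -> C) (z : C) :
  @continuous C_UniformSpace C_UniformSpace g z ->
  @continuous C_UniformSpace C_UniformSpace d z ->
  @continuous C_UniformSpace C_UniformSpace (fun u => dstretch (g u) (d u)) z.
Proof.
  assert (twice_Re : forall h : C -> C,
            @continuous C_UniformSpace C_UniformSpace h z ->
            @continuous C_UniformSpace R_UniformSpace (fun u => 2 * Re (h u)) z).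
  { intros h Hh. apply (continuous_mult (K := R_AbsRing) (fun _ => 2)).
    - apply continuous_const.
    - apply continuous_Re, Hh. }
  intros Hg Hd. apply continuous_Cmult.
  - apply continuous_Cplus; [exact Hd |].
    apply continuous_Cmult; [| exact Hg].
    apply continuous_RtoC, twice_Re, Hd.
  - apply continuous_RtoC.
    apply (continuous_comp (U := C_UniformSpace) (V := R_UniformSpace)
             (W := R_UniformSpace) (fun u => 2 * Re (g u)) exp).
    + apply twice_Re, Hg.
    + apply continuous_exp.
Qed.

Lemma C1_on_disk_f_half : C1_on_disk f_half.
Proof.
  intros z Hz. apply unit_disk_Re_lt_1 in Hz.
  pose proof (continuous_cayley z Hz) as Hc.
  pose proof (continuous_dcayley z Hz) as Hd.
  pose proof (locally_Re_lt_1 z Hz) as Hloc.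
  split; [apply ex_partials_f_half, Hz | split].
  - eapply (continuous_ext_loc (T := C_UniformSpace) (U := C_UniformSpace)).
    + eapply filter_imp; [| exact Hloc].
      intros u Hu. symmetry. exact (partial_x_f_half u Hu).
    + apply continuous_dstretch; assumption.
  - eapply (continuous_ext_loc (T := C_UniformSpace) (U := C_UniformSpace)).
    + eapply filter_imp; [| exact Hloc].
      intros u Hu. symmetry. exact (partial_y_f_half u Hu).
    + apply (continuous_dstretch cayley (fun u => Ci * dcayley u)%C);
        [exact Hc |].
      apply continuous_Cmult; [apply continuous_const | exact Hd].
Qed.

(** * The log-harmonic equation *)

(** In [partial_x + Ci * partial_y] the terms [d] and [Ci * (Ci * d)] cancel.
    What remains comes from the exponential factor, with coefficient
    [2 Re d + Ci * 2 Re (Ci * d)], which is twice the conjugate of [d]. *)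
Lemma wirtinger_zbar_f_half (z : C) : Re z < 1 ->
  wirtinger_zbar f_half z = (Cconj (dcayley z) * f_half z)%C.
Proof.
  intros Hz. unfold wirtinger_zbar.
  rewrite partial_x_f_half, partial_y_f_half, f_half_stretch by exact Hz.
  unfold stretch, dstretch. generalize (cayley z), (dcayley z).
  intros w d. set (E := exp (2 * Re w)).
  apply injective_projections;
    unfold Ci, Cconj, Cdiv, Cinv, Cmult, Cplus, Cminus, Copp, RtoC, Re, Im;
    simpl; field.
Qed.

Lemma wirtinger_z_f_half (z : C) : Re z < 1 ->
  wirtinger_z f_half z
  = (dcayley z * (RtoC 1 + cayley z) * RtoC (exp (2 * Re (cayley z))))%C.
Proof.
  intros Hz. unfold wirtinger_z.
  rewrite partial_x_f_half, partial_y_f_half by exact Hz.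
  unfold dstretch. generalize (cayley z), (dcayley z).
  intros w d. set (E := exp (2 * Re w)).
  apply injective_projections;
    unfold Ci, Cdiv, Cinv, Cmult, Cplus, Cminus, Copp, RtoC, Re, Im;
    simpl; field.
Qed.

Lemma exp_neq_0_C (x : R) : RtoC (exp x) <> RtoC 0.
Proof.
  intros H. apply (f_equal Re) in H. pose proof (exp_pos x).
  unfold Re in H; simpl in H. lra.
Qed.

(** This identity, [z = w / (1 + w)], is what makes the dilatation equal to [z]. *)
Lemma cayley_mult_id (z : C) : Re z < 1 ->
  (z * (RtoC 1 + cayley z))%C = cayley z.
Proof.
  intros Hz. unfold cayley. field. apply one_minus_neq_0, Hz.
Qed.

Lemma f_half_equation (z : C) : Re z < 1 ->
  Cconj (wirtinger_zbar f_half z)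
  = (z * (Cconj (f_half z) / f_half z) * wirtinger_z f_half z)%C.
Proof.
  intros Hz.
  rewrite wirtinger_zbar_f_half, wirtinger_z_f_half by exact Hz.
  rewrite Cmult_conj, Cconj_conj, f_half_stretch.
  unfold stretch.
  pose proof (exp_neq_0_C (2 * Re (cayley z))) as HE.
  pose proof (cayley_mult_id z Hz) as Hid.
  set (E := RtoC (exp (2 * Re (cayley z)))) in *.
  destruct (Ceq_dec (cayley z) 0) as [H0 | H0].
  (* The origin is the only zero of the mapping; both sides vanish there, the
     right-hand one because of the factor [z]. *)
  - rewrite H0 in *.
    assert (z = RtoC 0) as -> by (rewrite <- Hid; ring).
    rewrite !Cmult_0_l.
    replace (Cconj 0) with (RtoC 0) by (apply injective_projections; simpl; ring).
    ring.
  - transitivity (dcayley z * Cconj (cayley z * E) *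
      ((z * (RtoC 1 + cayley z)) / cayley z))%C.
    + rewrite Hid. field. exact H0.
    + field. split; assumption.
Qed.

(** The domain carries the normed-module structure of the absolute ring and the
    codomain the one built on the product topology, so the general fact about
    the identity of a single normed module does not apply; the remainder in the
    definition of the derivative is computed to be zero. *)
Lemma analytic_on_disk_id : analytic_on_disk (fun z : C => z).
Proof.
  intros z _. exists (RtoC 1). split.
  - exact (is_linear_scal_l (K := C_AbsRing) (V := C_NormedModule) (RtoC 1)).
  - intros x Hx eps. apply filter_forall. intros y.
    change (Cmod ((y - x) - (y - x) * RtoC 1)%C <= eps * Cmod (y - x)%C).
    replace ((y - x) - (y - x) * RtoC 1)%C with (RtoC 0)
      by (apply injective_projections; simpl; ring).
    rewrite Cmod_0.
    apply Rmult_le_pos; [apply Rlt_le, cond_pos | apply Cmod_ge_0].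
Qed.

Lemma log_harmonic_f_half : log_harmonic_with (fun z : C => z) f_half.
Proof.
  split; [| split; [| split]].
  - exact analytic_on_disk_id.
  - intros z Hz. exact Hz.
  - exact C1_on_disk_f_half.
  - intros z Hz. apply f_half_equation, unit_disk_Re_lt_1, Hz.
Qed.

(** * The disk and the half-plane *)

Definition cayley_inv (w : C) : C := (w / (RtoC 1 + w))%C.

Lemma cayleyK (z : C) : Re z < 1 -> cayley_inv (cayley z) = z.
Proof.
  intros Hz. pose proof (one_minus_neq_0 z Hz) as H1.
  unfold cayley_inv, cayley. field. split; [exact H1 |].
  replace (RtoC 1 - z + z)%C with (RtoC 1) by ring.
  apply C1_nz.
Qed.

Lemma cayley_invK (w : C) : Re w > - (1 / 2) -> cayley (cayley_inv w) = w.
Proof.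
  intros Hw.
  assert (H1 : (RtoC 1 + w)%C <> RtoC 0).
  { intros H. apply (f_equal Re) in H. unfold Re in *; simpl in H. lra. }
  unfold cayley_inv, cayley. field. split; [exact H1 |].
  replace (RtoC 1 + w - w)%C with (RtoC 1) by ring.
  apply C1_nz.
Qed.

Lemma unit_disk_sqr (x y : R) : unit_disk (x, y) <-> x ^ 2 + y ^ 2 < 1.
Proof.
  unfold unit_disk, Cmod; simpl fst; simpl snd. split; intros H.
  - rewrite <- sqrt_1 in H. apply sqrt_lt_0_alt in H. exact H.
  - rewrite <- sqrt_1. apply sqrt_lt_1_alt. split; [nra | exact H].
Qed.

(** This rests on [1 + 2 Re w = (1 - |z|^2) / |1 - z|^2]. *)
Lemma cayley_half_plane (z : C) : unit_disk z -> Re (cayley z) > - (1 / 2).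
Proof.
  destruct z as [x y]. intros Hz.
  pose proof (unit_disk_Re_lt_1 _ Hz) as Hx. simpl in Hx.
  apply unit_disk_sqr in Hz.
  pose proof (norm_one_minus_pos x y Hx) as HN.
  rewrite cayley_components by exact Hx.
  unfold Re; cbn [fst].
  apply Rlt_gt.
  replace ((x * (1 - x) - y ^ 2) / ((1 - x) ^ 2 + y ^ 2)) with
    (- (1 / 2) + (1 - (x ^ 2 + y ^ 2)) / (2 * ((1 - x) ^ 2 + y ^ 2)))
    by (field; lra).
  assert (0 < (1 - (x ^ 2 + y ^ 2)) / (2 * ((1 - x) ^ 2 + y ^ 2)))
    by (apply Rdiv_lt_0_compat; lra).
  lra.
Qed.

(** The half-plane [Re w > -1/2] consists of the points closer to 0 than
    to -1. *)
Lemma cayley_inv_disk (w : C) : Re w > - (1 / 2) -> unit_disk (cayley_inv w).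
Proof.
  intros Hw.
  assert (Hlt : Cmod w < Cmod (RtoC 1 + w)).
  { destruct w as [u v]. simpl in Hw. unfold Cmod; simpl fst; simpl snd.
    apply sqrt_lt_1_alt. simpl. nra. }
  pose proof (Cmod_ge_0 w).
  unfold unit_disk, cayley_inv, Cdiv. rewrite Cmod_mult, Cmod_inv.
  - apply Rlt_div_l; lra.
  - apply Cmod_gt_0. lra.
Qed.

(** * The stretch of the half-plane *)

(** After division by [exp (2 * u2)] the claim is
    [u1 * exp (-2d) < u2] with [d = u2 - u1].  For negative [u1] the bound
    [exp (-2d) > 1 - 2d] gives [u1 * exp (-2d) < u1 - 2 * u1 * d <= u1 + d],
    the last step being exactly the hypothesis [-1/2 <= u1]. *)
Lemma mult_exp_lt (u1 u2 : R) : - (1 / 2) <= u1 -> u1 < u2 ->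
  u1 * exp (2 * u1) < u2 * exp (2 * u2).
Proof.
  intros H1 H2.
  assert (Hd : u1 * exp (- (2 * (u2 - u1))) < u2).
  { destruct (Rlt_le_dec u1 0) as [Hneg | Hpos].
    - pose proof (exp_ineq1 (- (2 * (u2 - u1))) ltac:(lra)). nra.
    - assert (exp (- (2 * (u2 - u1))) < 1)
        by (rewrite <- exp_0; apply exp_increasing; lra).
      nra. }
  replace (2 * u1) with (- (2 * (u2 - u1)) + 2 * u2) by ring.
  rewrite exp_plus, <- Rmult_assoc.
  apply Rmult_lt_compat_r; [apply exp_pos | exact Hd].
Qed.

Lemma mult_exp_inj (u1 u2 : R) : - (1 / 2) <= u1 -> - (1 / 2) <= u2 ->
  u1 * exp (2 * u1) = u2 * exp (2 * u2) -> u1 = u2.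
Proof.
  intros H1 H2 H. destruct (Rtotal_order u1 u2) as [L | [E | L]].
  - pose proof (mult_exp_lt u1 u2 H1 L). lra.
  - exact E.
  - pose proof (mult_exp_lt u2 u1 H2 L). lra.
Qed.

Lemma mult_exp_min : - (1 / 2) * exp (2 * - (1 / 2)) = - (1 / (2 * exp 1)).
Proof.
  replace (2 * - (1 / 2)) with (- (1)) by field.
  rewrite exp_Ropp. field. apply Rgt_not_eq, exp_pos.
Qed.

(** Intermediate values between [-1/2] and [max c 0], where the function is at
    least [c] because [exp] is at least 1 there. *)
Lemma mult_exp_surj (c : R) : c > - (1 / (2 * exp 1)) ->
  exists u : R, u > - (1 / 2) /\ u * exp (2 * u) = c.
Proof.
  intros Hc. rewrite <- mult_exp_min in Hc.
  set (b := Rmax c 0).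
  assert (Hb0 : 0 <= b) by apply Rmax_r.
  assert (Hbc : c <= b) by apply Rmax_l.
  assert (Hbe : c <= b * exp (2 * b)).
  { pose proof (exp_ineq1_le (2 * b)). nra. }
  destruct (IVT_gen_consistent (fun u => u * exp (2 * u)) (- (1 / 2)) b c)
    as [u [Hu Hval]].
  - intros u. apply (ex_derive_continuous (V := R_NormedModule)).
    auto_derive. exact I.
  - split.
    + eapply Rle_trans; [apply Rmin_l | lra].
    + eapply Rle_trans; [exact Hbe | apply Rmax_r].
  - rewrite Rmin_left in Hu by lra.
    exists u. split; [| exact Hval].
    destruct (proj1 Hu) as [L | E]; [exact L |].
    rewrite <- E in Hval. lra.
Qed.

Lemma stretch_inj (w1 w2 : C) : Re w1 > - (1 / 2) -> Re w2 > - (1 / 2) ->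
  stretch w1 = stretch w2 -> w1 = w2.
Proof.
  destruct w1 as [u1 v1], w2 as [u2 v2].
  rewrite !stretch_components. unfold Re, Im; cbn [fst snd].
  intros H1 H2 H. injection H as HRe HIm.
  apply mult_exp_inj in HRe; [| lra | lra]. subst u2.
  apply Rmult_eq_reg_r in HIm; [| apply Rgt_not_eq, exp_pos].
  congruence.
Qed.

Lemma univalent_f_half : univalent_on_disk f_half.
Proof.
  intros z1 z2 H1 H2 H. rewrite !f_half_stretch in H.
  apply stretch_inj in H; [| apply cayley_half_plane; assumption ..].
  rewrite <- (cayleyK z1), <- (cayleyK z2) by (apply unit_disk_Re_lt_1; assumption).
  f_equal. exact H.
Qed.

Lemma maps_onto_f_half :
  maps_disk_onto f_half (fun w : C => Re w > - (1 / (2 * exp 1))).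
Proof.
  intros w. split.
  - intros Hw. destruct (mult_exp_surj (Re w) Hw) as [u [Hu Hval]].
    exists (cayley_inv (u, Im w / exp (2 * u))). split.
    + apply cayley_inv_disk. exact Hu.
    + rewrite f_half_stretch, cayley_invK by exact Hu.
      rewrite stretch_components. apply injective_projections; simpl.
      * exact Hval.
      * unfold Im. field. apply Rgt_not_eq, exp_pos.
  - intros [z [Hz <-]]. pose proof (cayley_half_plane z Hz) as Hu.
    rewrite f_half_stretch, stretch_components, <- mult_exp_min.
    exact (mult_exp_lt _ _ (Rle_refl _) Hu).
Qed.

(** * The mapping theorem *)

Theorem mainTheorem4 :
  log_harmonic_with (fun z : C => z) f_half /\
  univalent_on_disk f_half /\
  maps_disk_onto f_half (fun w : C => Re w > - (1 / (2 * exp 1))).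
Proof.
  exact (conj log_harmonic_f_half (conj univalent_f_half maps_onto_f_half)).
Qed.
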